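(* Let $E$ be a nonempty set and let $(E,\mathbf{U})$ be a uniform convergence space (in the sense of Beattie–Butzmann). Let $E' = \mathrm{Fil}(E)$ be the set of all filters on $E$, let $T:\mathcal{P}(E)\to\mathcal{P}(E')$ be defined by $T(\emptyset)=\emptyset$ and $T(A)=\{\mathcal{F}\in \mathrm{Fil}(E) \mid A\in\mathcal{F}\}$ for $\emptyset\neq A\subseteq E$, and let $$\Xi_{\mathbf{U}}=\{(\mathcal{F},\mathcal{G})\in \mathrm{Fil}(E)\times \mathrm{Fil}(E) \mid \mathcal{F}\times\mathcal{G}\in\mathbf{U}\},$$ where $\mathcal{F}\times\mathcal{G}=\{C\subseteq E\times E \mid \exists\, A\in\mathcal{F},\ B\in\mathcal{G}:\ A\times B\subseteq C\}$. Then $\sigma_{\mathbf{U}}=(E,E',T,\Xi_{\mathbf{U}})$ is a topological type structure (TTS) on $E$.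
   Context: Filters are proper: a filter on a set is a nonempty family of nonempty subsets closed under supersets and finite intersections. $\mathrm{Fil}(X)$ denotes the set of all filters on $X$, and $\mathcal{P}(X)$ the power set of $X$. Uniform convergence space: a uniform convergence structure on $E$ is a set $\mathbf{U}\subseteq \mathrm{Fil}(E\times E)$ such that: (i) $\mathcal{U}_{(x,x)}\in\mathbf{U}$ for every $x\in E$, where $\mathcal{U}_{(x,x)}=\{C\subseteq E\times E\mid (x,x)\in C\}$; (ii) $\mathcal{U},\mathcal{V}\in\mathbf{U}$ implies $\mathcal{U}\cap\mathcal{V}\in\mathbf{U}$; (iii) $\mathcal{U}\in\mathbf{U}$, $\mathcal{V}\in\mathrm{Fil}(E\times E)$ and $\mathcal{V}\supseteq\mathcal{U}$ imply $\mathcal{V}\in\mathbf{U}$; (iv) $\mathcal{U}\in\mathbf{U}$ implies $\mathcal{U}^{-1}\in\mathbf{U}$, where $\mathcal{U}^{-1}=\{C^{-1}\mid C\in\mathcal{U}\}$ and $C^{-1}=\{(y,x)\mid (x,y)\in C\}$; (v) if $\mathcal{U},\mathcal{V}\in\mathbf{U}$ and $\mathcal{U}\circ\mathcal{V}\in\mathrm{Fil}(E\times E)$, then $\mathcal{U}\circ\mathcal{V}\in\mathbf{U}$, where $\mathcal{U}\circ\mathcal{V}=\{C\subseteq E\times E\mid \exists\, A\in\mathcal{U},\ B\in\mathcal{V}:\ A\circ B\subseteq C\}$ and $A\circ B=\{(x,z)\mid \exists\, y\in E:\ (x,y)\in A,\ (y,z)\in B\}$. Then $(E,\mathbf{U})$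 is called a uniform convergence space. TTS: a topological type structure on a nonempty set $E$ is a quadruplet $\sigma=(E,E',T,\Xi)$, where $E'$ is a nonempty set, $T:\mathcal{P}(E)\to\mathcal{P}(E')$ is a map and $\Xi\subseteq E'\times E'$ is a binary relation (written $x'\,\Xi\,y'$ for $(x',y')\in\Xi$), such that: (TTP1) $\emptyset\neq A\subseteq B\subseteq E$ implies $\emptyset\neq T(A)\subseteq T(B)\subseteq E'$; (TTP2) $T(E)=E'$; (TTS1) for all $x\in E$ and all $x',y'\in T(\{x\})$: $x'\,\Xi\,y'$; (TTS2) for all $x',y'\in E'$: $x'\,\Xi\,y'$ implies $y'\,\Xi\,x'$; (TTS3) for all $x',y'\in E'$: $x'\,\Xi\,y'$ implies $x'\,\Xi\,x'$. *)

(* Defs.v *)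
From mathcomp Require Import all_boot.
From mathcomp Require Import boolp classical_sets filter.

Set Implicit Arguments.
Unset Strict Implicit.
Unset Printing Implicit Defensive.

Local Open Scope classical_set_scope.

(* A filter on X is a set system satisfying [ProperFilter]; the set Fil(X) is
   the type [pfilter_on X]. *)

Definition filter_inv (E : Type) (U : set_system (E * E)) :
    set_system (E * E) :=
  [set (C^-1)%relation | C in U].

(* Since [B \; A = [set x | exists2 y, A (x.1, y) & B (y, x.2)]], the relation
   [B \; A] is the A o B for which (x, y) is in A and (y, z) in B. *)
Definition filter_comp (E : Type) (U V : set_system (E * E)) :
    set_system (E * E) :=
  [set C | exists A B, [/\ U A, V B & (B \; A)%relation `<=` C]].

Record uniform_convergence_structure (E : Type)
    (UU : set (set_system (E * E))) : Prop := {
  ucs_proper : forall U, UU U -> ProperFilter U;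
  ucs_point : forall x : E, UU [set C | C (x, x)];
  ucs_setI : forall U V, UU U -> UU V -> UU (U `&` V);
  ucs_super : forall U V, UU U -> ProperFilter V -> U `<=` V -> UU V;
  ucs_inv : forall U, UU U -> UU (filter_inv U);
  ucs_comp : forall U V, UU U -> UU V ->
    ProperFilter (filter_comp U V) -> UU (filter_comp U V)
}.

(* The sets E and E' are types, so the inclusion of T(B) in E' holds by typing
   and T(E) = E' reads [T setT = setT]. *)
Record is_TTS (E E' : Type) (T : set E -> set E') (Xi : set (E' * E')) :
    Prop := {
  tts_nonempty : [set: E] !=set0;
  tts_nonempty' : [set: E'] !=set0;
  TTP1 : forall A B : set E, A !=set0 -> A `<=` B ->
    T A !=set0 /\ T A `<=` T B;
  TTP2 : T [set: E] = [set: E'];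
  TTS1 : forall (x : E) (x' y' : E'),
    T [set x] x' -> T [set x] y' -> Xi (x', y');
  TTS2 : forall x' y' : E', Xi (x', y') -> Xi (y', x');
  TTS3 : forall x' y' : E', Xi (x', y') -> Xi (x', x')
}.

Definition filters_at (E : Type) (A : set E) : set (pfilter_on E) :=
  if A == set0 then set0 else [set F | F A].

(* [filter_prod F G] is the filter generated by the products A `*` B with
   F A and G B. *)
Definition Xi_of (E : Type) (UU : set (set_system (E * E))) :
    set (pfilter_on E * pfilter_on E) :=
  [set FG : pfilter_on E * pfilter_on E | UU (filter_prod FG.1 FG.2)].

(* Main.v *)
(** The only filter containing [{x}] is the principal one, so products of two
    such filters refine U_(x,x) (TTS1). The inverse of F x G is G x F, which
    gives TTS2. Since any two members of G meet, (F x G) o (G x F) = F x F, so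
    this composite is a proper filter and axiom (v) gives TTS3. *)

Require Import Defs.
From mathcomp Require Import all_boot.
From mathcomp Require Import boolp classical_sets filter.

Local Open Scope classical_set_scope.

(** The two sides can differ only at [A = set0], which no proper filter contains. *)
Lemma filters_atE (E : Type) (A : set E) (F : pfilter_on E) :
  filters_at A F <-> F A.
Proof.
rewrite /filters_at; case: eqP => [->|] //; split => // F0.
exact: (@filter_not_empty _ F _ F0).
Qed.

(** This inclusion suffices for symmetry, as axiom (iii) passes to finer proper filters. *)
Lemma filter_inv_prod (E : Type) (F G : set_system E) :
  filter_inv (filter_prod F G) `<=` filter_prod G F.
Proof.
move=> _ [C [[A B] /= [FA GB] ABC] <-].
by exists (B, A) => // -[y x] /= [By Ax]; apply: ABC.
Qed.

Lemma filter_comp_prod (E : Type) (F G H : set_system E)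
    {FF : Filter F} {GP : ProperFilter G} {HF : Filter H} :
  filter_comp (filter_prod F G) (filter_prod G H) = filter_prod F H.
Proof.
apply/seteqP; split=> C.
  case=> A [B [[[P Q] /= [FP GQ] PQA] [[Q' R] /= [GQ' HR] QRB] ABC]].
  have [y [Qy Q'y]] := filter_ex (filterI GQ GQ').
  exists (P, R) => // -[x z] /= [Px Rz]; apply: ABC; exists y => /=.
    exact: PQA.
  exact: QRB.
move=> [[P R] /= [FP HR] PRC].
(* With the middle coordinate left free, the composite lies in [P]*[R]. *)
exists (P `*` setT), (setT `*` R); split.
- by exists (P, setT) => //; split=> //; exact: filterT.
- by exists (setT, R) => //; split=> //; exact: filterT.
- by move=> [x z] /= [y [Px _] [_ Rz]]; apply: PRC.
Qed.

Theorem mainTheorem2 (E : Type) (UU : set (set_system (E * E)))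
    (E_nonempty : [set: E] !=set0)
    (UU_ucs : uniform_convergence_structure UU) :
  is_TTS (@filters_at E) (Xi_of UU).
Proof.
(* Principal filters witness that E' and T(A), for nonempty A, are nonempty. *)
have principal (x : E) : ProperFilter [set A : set E | A x].
  by split=> //; split=> // A B AB; apply: AB.
have Xi_sym (F G : pfilter_on E) : Xi_of UU (F, G) -> Xi_of UU (G, F).
  rewrite /Xi_of /= => /(ucs_inv UU_ucs) UFG.
  by apply: (ucs_super UU_ucs UFG); exact: filter_inv_prod.
split=> //.
- by have [x _] := E_nonempty; exists (PFilterPack _ (principal x)).
- move=> A B [x Ax] AB; split.
    by exists (PFilterPack _ (principal x)); apply/filters_atE.
  by move=> F /filters_atE FA; apply/filters_atE; exact: filterS FA.
- by apply/seteqP; split=> // F _; apply/filters_atE; exact: filterT.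
- move=> x F G /filters_atE Fx /filters_atE Gx.
  apply: (ucs_super UU_ucs (ucs_point UU_ucs x)) => C /= Cx.
  by exists ([set x], [set x]) => // -[_ _] /= [-> ->].
- move=> F G FG; have GF := Xi_sym _ _ FG.
  rewrite /Xi_of /= in FG GF *.
  have FGF : filter_comp (filter_prod F G) (filter_prod G F) = filter_prod F F.
    exact: filter_comp_prod.
  (* [FGF] also turns the properness demanded by axiom (v) into that of F x F. *)
  by rewrite -FGF; apply: ucs_comp => //; rewrite FGF; exact: filter_prod_proper.
Qed.
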